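(* Fix $d\ge2$, $m>0$, $\beta>0$. For each $n\ge 2$ let $(g_x)_{x\in\mathcal X}$ be the Gaussian free field without boundary on the Hamming graph $\mathcal X=\{0,1,\ldots,n-1\}^d$ with mass $m$, inverse temperature $\beta$ and interaction weights $J_1,\ldots,J_d$, and with associated eigenvalues $\lambda_0,\ldots,\lambda_d$, as defined in the context. For $(x,x')\in\mathcal X\times\mathcal X$ with Hamming distance $\rho=\rho(x,x')$, the covariance satisfies $$\mathrm{Cov}(g_x,g_{x'})=\frac{C_{m,d}(\rho)}{\beta}\,e^{-\rho\log n}+O(n^{-\rho-1}),\qquad n\to\infty,$$ where $$C_{m,d}(\rho)=\lim_{n\to\infty}\sum_{i=0}^\rho\binom\rho i\frac{(-1)^i}{1+m^2-\lambda_{i+d-\rho}}$$ (this limit being assumed to exist).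
   Context: $\rho(x,x')=|\{i:x_i\ne x_i'\}|$ is the Hamming distance; $R_i=\{(x,x')\in\mathcal X\times\mathcal X:\rho(x,x')=i\}$ (ordered pairs); $\kappa_i=\binom di(n-1)^i$. Weights $J_i\ge0$, $i=1,\ldots,d$, satisfy $\sum_{i=1}^d\kappa_iJ_i\le1$ and do not depend on $m$ or $\beta$. The Hamiltonian is $H\{(\xi_x)\}=\frac14\sum_{i=1}^dJ_i\sum_{(x,x')\in R_i}(\xi_x-\xi_{x'})^2+\frac{m^2}2\sum_{x\in\mathcal X}\xi_x^2$, and $(g_x)_{x\in\mathcal X}$ is the random vector in $\mathbb R^{\mathcal X}$ with density proportional to $e^{-\beta H}$. Put $w_i=\kappa_iJ_i$ for $1\le i\le d$, $w_0=1-\sum_{i=1}^dw_i$, and $$\lambda_i=\sum_{j=0}^d\frac{w_j}{\kappa_j}K_j(i),\qquad K_i(j)=\sum_{l=\max(0,i+j-d)}^{\min(i,j)}(-1)^l(n-1)^{i-l}\binom jl\binom{d-j}{i-l}$$ (Krawtchouk polynomials). In the limit $n\to\infty$ the distance $\rho$ is held fixed.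
   Formalization: The weights J_i may depend on n, and each w_i = κ_i J_i (1≤i≤d) is assumed to converge as n→∞ with error O(1/n); otherwise the claim fails, e.g. d=2, ρ=0, w_1=1/2+1/(2 log n), w_2=0 gives an error of order 1/log n. *)

(* Defs.v *)
From HB Require Import structures.
From mathcomp Require Import all_boot all_order all_algebra.
From mathcomp Require Import all_classical all_reals all_analysis.

Set Implicit Arguments.
Unset Strict Implicit.
Unset Printing Implicit Defensive.
Import Order.TTheory GRing.Theory Num.Theory.
Import numFieldNormedType.Exports.
Local Open Scope classical_set_scope.
Local Open Scope ring_scope.

(* lebesgue_measure lives on measurableTypeR R, not on R with its default
   display; the sigma-algebra on tuples is the product one. *)
Notation Rtuple R N := (N.-tuple (measurableTypeR R)).

Section lebesgue_tuple_step.
Context (R : realType) (N : nat).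
Variable mu : {sigma_finite_measure set (Rtuple R N) -> \bar R}.

Let tcons (p : measurableTypeR R * Rtuple R N) : Rtuple R N.+1 :=
  [tuple of p.1 :: p.2].

Let measurable_tcons : measurable_fun setT tcons.
Proof. exact: measurable_cons. Qed.

Definition lebesgue_tuple_step : set (Rtuple R N.+1) -> \bar R :=
  pushforward (lebesgue_measure \x mu)%E tcons.

Let step0 : lebesgue_tuple_step set0 = 0%E.
Proof. by rewrite /lebesgue_tuple_step /pushforward preimage_set0 measure0. Qed.

Let step_ge0 A : (0 <= lebesgue_tuple_step A)%E.
Proof. exact: measure_ge0. Qed.

Let step_additive : semi_sigma_additive lebesgue_tuple_step.
Proof.
by rewrite /lebesgue_tuple_step; exact: measure_semi_sigma_additive.
Qed.

HB.instance Definition _ := isMeasure.Build _ _ _ lebesgue_tuple_step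
  step0 step_ge0 step_additive.

Let step_sigma_finite : sigma_finite setT lebesgue_tuple_step.
Proof.
have /sigma_finiteP[F [TF ndF Foo]] := sigma_finiteT (@lebesgue_measure R).
have /sigma_finiteP[G [TG ndG Goo]] := sigma_finiteT mu.
pose hd (t : Rtuple R N.+1) := tnth t ord0.
pose tl (t : Rtuple R N.+1) : Rtuple R N := [tuple of behead t].
exists (fun n => (hd @^-1` F n) `&` (tl @^-1` G n)) => [|n].
  apply/seteqP; split=> // t _.
  have [n _ Fn] : (\bigcup_i F i) (hd t) by rewrite -TF.
  have [k _ Gk] : (\bigcup_i G i) (tl t) by rewrite -TG.
  exists (maxn n k) => //; split.
    by have /subsetPset := ndF _ _ (leq_maxl n k); exact.
  by have /subsetPset := ndG _ _ (leq_maxr n k); exact.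
have [mF Fn_oo] := Foo n; have [mG Gn_oo] := Goo n; split.
  apply: measurableI; rewrite -[X in measurable X]setTI.
    exact: measurable_tnth.
  exact: measurable_behead.
rewrite /lebesgue_tuple_step /pushforward.
have tlE p : tl (tcons p) = p.2 by apply/val_inj.
rewrite (_ : _ @^-1` _ = F n `*` G n); last first.
  by apply/seteqP; split=> -[x t]; rewrite /= /hd tnth0 tlE.
by rewrite product_measure1E// lte_mul_pinfty// ge0_fin_numE.
Qed.

HB.instance Definition _ := Measure_isSigmaFinite.Build _ _ _
  lebesgue_tuple_step step_sigma_finite.

End lebesgue_tuple_step.

Fixpoint lebesgue_tuple (R : realType) (N : nat) :
    {sigma_finite_measure set (Rtuple R N) -> \bar R} :=
  if N is N'.+1 then lebesgue_tuple_step (lebesgue_tuple R N')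
  else \d_([tuple] : Rtuple R 0).

Lemma lebesgue_tuple_box (R : realType) (N : nat)
    (A : 'I_N -> set (measurableTypeR R)) :
  (forall i, measurable (A i)) ->
  lebesgue_tuple R N [set t | forall i, A i (tnth t i)] =
  (\prod_(i < N) lebesgue_measure (A i))%E.
Proof.
elim: N A => [|N IH] A mA.
  rewrite big_ord0 /= diracE mem_set //; by case.
rewrite big_ord_recl -IH // -product_measure1E //; last first.
  rewrite (_ : mkset _ = \bigcap_(i in [set: 'I_N])
      (fun t : Rtuple R N => tnth t i) @^-1` A (lift ord0 i)); last first.
    by apply/seteqP; split=> t /= h i; [move=> _|]; exact: h.
  apply: fin_bigcap_measurable => // i _.
  by rewrite -[X in measurable X]setTI; exact: measurable_tnth.
rewrite /= /lebesgue_tuple_step /pushforward; congr (product_measure1 _ _ _).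
apply/seteqP; split=> -[x t] /=.
  move=> h; split=> [|i]; first by have := h ord0; rewrite tnth0.
  by have := h (lift ord0 i); rewrite tnthS.
case=> Ax At i; case: (unliftP ord0 i) => [j|] ->; last by rewrite tnth0.
by rewrite tnthS.
Qed.

Notation config d n := {ffun 'I_d -> 'I_n}.

Definition hdist (d n : nat) (x y : config d n) : nat :=
  #|[pred i | x i != y i]|.

(* All formulas below are meant for n >= 2, so that n.-1 is n - 1. *)
Definition kappa (R : realType) (d n i : nat) : R :=
  ('C(d, i) * n.-1 ^ i)%:R.

(* The lower bound i + j - d is truncated, hence equals max(0, i + j - d). *)
Definition krawtchouk (R : realType) (d n i j : nat) : R :=
  \sum_(i + j - d <= l < (minn i j).+1)
    (-1) ^+ l * n.-1%:R ^+ (i - l) * 'C(j, l)%:R * 'C(d - j, i - l)%:R.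

(* Only the values J 1, ..., J d of J : nat -> R are used. *)
Definition shell_weight (R : realType) (d n : nat) (J : nat -> R)
    (i : nat) : R :=
  if i == 0%N then 1 - \sum_(1 <= j < d.+1) kappa R d n j * J j
  else kappa R d n i * J i.

Definition hamming_eigenvalue (R : realType) (d n : nat) (J : nat -> R)
    (i : nat) : R :=
  \sum_(0 <= j < d.+1)
    shell_weight d n J j / kappa R d n j * krawtchouk R d n j i.

Definition hamiltonian (R : realType) (d n : nat) (J : nat -> R) (m : R)
    (xi : config d n -> R) : R :=
  4^-1 * (\sum_(1 <= i < d.+1)
            J i * \sum_(p : config d n * config d n | hdist p.1 p.2 == i)
                    (xi p.1 - xi p.2) ^+ 2)
  + m ^+ 2 / 2 * \sum_(x : config d n) xi x ^+ 2.

(* R^X is represented by #|X|-tuples, through the enumeration of X. *)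
Definition field_of_tuple (R : realType) (d n : nat)
    (t : Rtuple R #|{: config d n}|) (x : config d n) : R :=
  tnth t (enum_rank x).

Definition tuple_of_field (R : realType) (d n : nat) (xi : config d n -> R) :
    Rtuple R #|{: config d n}| :=
  [tuple xi (enum_val i) | i < #|{: config d n}|].

(* The law of (g_x) on R^X has density c * exp (- beta H); since P is a
   probability, c is necessarily the inverse of the partition function. *)
Definition is_gff (R : realType) (d n : nat) (J : nat -> R) (m beta : R)
    (disp : measure_display) (T : measurableType disp) (P : probability T R)
    (g : config d n -> {RV P >-> R}) : Prop :=
  exists c : R, forall A : set (Rtuple R #|{: config d n}|), measurable A ->
    P [set omega | A (tuple_of_field (fun x => g x omega))] =
    (c%:E * \int[lebesgue_tuple R #|{: config d n}|]_(t in A)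
              (expR (- (beta * hamiltonian J m (field_of_tuple t))))%:E)%E.

(* The sequence whose limit as n tends to infinity is C_{m,d}(rho). *)
Definition cov_coef (R : realType) (d n : nat) (J : nat -> R) (m : R)
    (rho : nat) : R :=
  \sum_(0 <= i < rho.+1)
    'C(rho, i)%:R * ((-1) ^+ i /
      (1 + m ^+ 2 - hamming_eigenvalue d n J (i + d - rho))).

(* Main.v *)
(* The Hamiltonian is half the quadratic form of Q = 1 + m^2 - sum_j w_j/kappa_j A_j,
   where A_j is the distance-j adjacency matrix.  The kernels eigenproj T, tensor
   products over the coordinates of (I - 1/n) on T and of the averaging 1/n off T,
   resolve the identity, and the generating function sum_j u^j A_j acts on
   eigenproj T by (1-u)^|T| (1+(n-1)u)^(d-|T|), so that A_j acts by K_j(|T|) and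
   Q^-1 = green = sum_T eigenproj T / (1 + m^2 - lambda_|T|).

   Completing the square and translating Lebesgue measure gives
   E exp<a,g> = exp(<a, green a> / (2 beta)), which identifies the covariance with
   green / beta; the normalization P(Omega) = 1 makes the partition function finite,
   so no Gaussian integral is computed.  Second moments are read off this generating
   function because (e^{sy} + e^{-sy} - 2)/s^2 decreases to y^2 along s = 2^-k.

   For x, x' differing exactly on D with |D| = rho, eigenproj T (x, x') is
   n^-rho (-1)^|T & D| + O(n^(-rho-1)) if T contains the complement of D and
   O(n^(-rho-1)) otherwise.  Since the eigenvalues are at most 1, summing over T
   yields n^-rho cov_coef + O(n^(-rho-1)), and cov_coef = C + O(1/n) because it is
   built from the weights and from 1/(n-1) by sums, products and inversions away
   from 0. *)
Require Import Defs.
From mathcomp Require Import all_boot all_order all_algebra zify ring lra.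
From mathcomp Require Import all_classical all_reals all_analysis
  measurable_realfun.

Set Implicit Arguments.
Unset Strict Implicit.
Unset Printing Implicit Defensive.
Import Order.TTheory GRing.Theory Num.Theory.
Import numFieldNormedType.Exports.
Local Open Scope classical_set_scope.
Local Open Scope ring_scope.

(** * Translation invariance and densities *)

Section lebesgue_tuple_translation.
Variable R : realType.

(** Lebesgue measure is the only measure giving half-open intervals their length, and translation
    preserves that length. *)
Lemma lebesgue_measure_shift (c : R) (A : set (measurableTypeR R)) :
  measurable A ->
  pushforward lebesgue_measure
    ((fun x => x + c) : measurableTypeR R -> measurableTypeR R) A =
  lebesgue_measure A.
Proof.
move=> mA; apply/esym/lebesgue_measure_unique => //= [|_ _ [[a b]] _ <-].
  by apply: measurable_funD.
rewrite /pushforward.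
have -> : (fun x => x + c) @^-1` `]a, b] = `]a - c, b - c]%classic.
  by apply/seteqP; split => x /=; rewrite !in_itv /= ltrBlDr lerBrDr.
rewrite !lebesgue_measure_itv /= !lte_fin ltrD2r.
by case: ifP => // _; rewrite -!EFinD; congr (_%:E); ring.
Qed.

Lemma ge0_integral_lebesgue_shift (c : R) (f : measurableTypeR R -> \bar R) :
  measurable_fun setT f -> (forall x, 0 <= f x)%E ->
  (\int[lebesgue_measure]_x f (x + c)%R = \int[lebesgue_measure]_x f x)%E.
Proof.
move=> mf f0.
have ms : measurable_fun setT
    ((fun x => x + c) : measurableTypeR R -> measurableTypeR R).
  by apply: measurable_funD.
rewrite -[LHS](@ge0_integral_pushforward _ _ _ _ _ _ ms _ setT f) //.
by apply: eq_measure_integral => A mA _; exact: lebesgue_measure_shift.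
Qed.

Definition tuple_shift N (b : 'I_N -> R) (t : Rtuple R N) : Rtuple R N :=
  [tuple tnth t i + b i | i < N].

Lemma measurable_tuple_shift N (b : 'I_N -> R) :
  measurable_fun setT (tuple_shift b).
Proof.
apply/measurable_fun_tnthP => i.
rewrite (_ : _ \o _ = fun t : Rtuple R N => tnth t i + b i); last first.
  by apply/funext => t; rewrite /= tnth_mktuple.
by apply: measurable_funD => //; exact: measurable_tnth.
Qed.

(** Tonelli, since the measure in dimension [N.+1] is the image of a product measure under
    consing. *)
Lemma ge0_integral_lebesgue_tupleS N (f : Rtuple R N.+1 -> \bar R) :
  measurable_fun setT f -> (forall t, 0 <= f t)%E ->
  (\int[lebesgue_tuple R N.+1]_t f t =
   \int[lebesgue_measure]_x \int[lebesgue_tuple R N]_t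
     f [the N.+1.-tuple (measurableTypeR R) of x :: t])%E.
Proof.
move=> mf f0.
have mc : measurable_fun setT (fun p : measurableTypeR R * Rtuple R N =>
    [the N.+1.-tuple (measurableTypeR R) of p.1 :: p.2]).
  exact: measurable_cons.
rewrite [LHS](@ge0_integral_pushforward _ _ _ _ _ _ mc _ setT f) //.
rewrite preimage_setT fubini_tonelli1 //; first exact: measurableT_comp.
by move=> x; exact: f0.
Qed.

(** Induction on [N]: the tail is shifted at a fixed head, then the one-dimensional invariance is
    applied to the inner integral [F]. *)
Lemma ge0_integral_tuple_shift N (b : 'I_N -> R) (f : Rtuple R N -> \bar R) :
  measurable_fun setT f -> (forall t, 0 <= f t)%E ->
  (\int[lebesgue_tuple R N]_t f (tuple_shift b t) =
   \int[lebesgue_tuple R N]_t f t)%E.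
Proof.
elim: N b f => [|N IH] b f mf f0.
  by apply: eq_integral => t _; congr f; rewrite [LHS]tuple0 [RHS]tuple0.
have mc : measurable_fun setT (fun p : measurableTypeR R * Rtuple R N =>
    [the N.+1.-tuple (measurableTypeR R) of p.1 :: p.2]).
  exact: measurable_cons.
rewrite ge0_integral_lebesgue_tupleS //; last first.
  by apply: measurableT_comp => //; exact: measurable_tuple_shift.
rewrite [RHS]ge0_integral_lebesgue_tupleS //.
pose F x := (\int[lebesgue_tuple R N]_t
  f [the N.+1.-tuple (measurableTypeR R) of x :: t])%E.
transitivity (\int[lebesgue_measure]_x F (x + b ord0)%R)%E.
  apply: eq_integral => x _; rewrite /F.
  have mx : measurable_fun setT (fun t : Rtuple R N =>
      [the N.+1.-tuple (measurableTypeR R) of (x + b ord0)%R :: t]).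
    by apply: measurable_cons; [exact: measurable_cst | exact: measurable_id].
  rewrite -(IH (fun i => b (lift ord0 i)) _ (measurableT_comp mf mx)) //=.
  apply: eq_integral => t _; congr f; apply: eq_from_tnth => i.
  rewrite tnth_mktuple; case: (unliftP ord0 i) => [j|] ->.
    by rewrite !tnthS tnth_mktuple.
  by rewrite !tnth0.
apply: ge0_integral_lebesgue_shift => [|x]; last exact: integral_ge0.
apply: (@measurable_fun_fubini_tonelli_F _ _ _ _ _ (lebesgue_tuple R N)
  (fun p => f [the N.+1.-tuple (measurableTypeR R) of p.1 :: p.2])) => //.
exact: measurableT_comp.
Qed.

End lebesgue_tuple_translation.

(** * Integration against a measure given by a density *)

Section density.
Context d (T : measurableType d) (R : realType).
Variables (mu nu : {measure set T -> \bar R}) (rho : T -> R).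
Hypothesis mrho : measurable_fun setT rho.
Hypothesis rho0 : forall x, 0 <= rho x.
Hypothesis nuE : forall A, measurable A ->
  nu A = (\int[mu]_(x in A) (rho x)%:E)%E.

Import HBNNSimple.

(** Both sides are monotone limits along simple functions, for which the identity reduces to [nuE]
    on each level set. *)
Lemma ge0_integral_density (f : T -> \bar R) :
  measurable_fun setT f -> (forall x, 0 <= f x)%E ->
  (\int[nu]_x f x = \int[mu]_x (f x * (rho x)%:E))%E.
Proof.
move=> mf f0; pose f_ := nnsfun_approx measurableT mf.
have cf x : (EFin \o f_ ^~ x) n @[n --> \oo] --> f x.
  by apply: cvg_nnsfun_approx.
transitivity (limn (fun n => \int[nu]_x (f_ n x)%:E)%E).
  rewrite -monotone_convergence//=.
  - by apply: eq_integral => x _; apply/esym/cvg_lim => //; exact: cf.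
  - by move=> n; exact/measurable_EFinP/measurable_funTS.
  - by move=> n x _; rewrite lee_fin.
  - by move=> x _ a b ab; rewrite lee_fin//; exact/lefP/nd_nnsfun_approx.
rewrite [RHS](_ : _ = limn (fun n => \int[mu]_x (f_ n x * rho x)%:E)%E);
    last first.
  rewrite -monotone_convergence//=.
  - apply: eq_integral => x _; apply/esym/cvg_lim => //.
    under eq_fun do rewrite EFinM.
    by apply: cvgeZr => //; exact: cf.
  - by move=> n; apply/measurable_EFinP; apply: measurable_funM.
  - by move=> n x _; rewrite lee_fin mulr_ge0.
  - move=> x _ a b ab; rewrite lee_fin ler_wpM2r //.
    exact/lefP/nd_nnsfun_approx.
congr (limn _); apply/funext => n.
have mA y : measurable (f_ n @^-1` [set y]) by exact: measurable_sfunP.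
under [LHS]eq_integral do rewrite fimfunE -fsumEFin//.
rewrite ge0_integral_fsum//; last 2 first.
  - by move=> y; exact/measurable_EFinP/measurable_funM.
  - by move=> y x _; rewrite nnfun_muleindic_ge0.
transitivity (\int[mu]_x (\sum_(y \in range (f_ n))
    (y * \1_(f_ n @^-1` [set y]) x * rho x)%:E))%E; last first.
  apply: eq_integral => x _; rewrite [X in (X * _)%:E]fimfunE fsumEFin//.
  by congr (_%:E); rewrite mulr_fsuml.
rewrite ge0_integral_fsum//; last 2 first.
  - move=> y; apply/measurable_EFinP; apply: measurable_funM => //.
    exact: measurable_funM.
  - by move=> y x _; rewrite EFinM mule_ge0 ?nnfun_muleindic_ge0 ?lee_fin.
apply: eq_fsbigr => y _.
rewrite integralZl_indic_nnsfun// integral_indic// setIT nuE//.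
(* A negative [y] is not a value of the nonnegative [f_ n], so its level set is empty; otherwise [y]
   can be pulled out of a nonnegative integral. *)
have [y0|y0] := ltP y 0.
  rewrite preimage_nnfun0 // integral_set0 mule0.
  by rewrite integral0_eq // => x _; rewrite indicE in_set0 mulr0 mul0r.
rewrite [in LHS]integral_mkcond -ge0_integralZl//.
- apply: eq_integral => x _; rewrite /patch indicE.
  by case: ifP => _; rewrite ?mulr1 ?mulr0 ?mul0r ?mule0 ?EFinM.
- apply/(measurable_restrictT _ (mA y)).
  exact/measurable_funTS/measurable_EFinP.
- by move=> x _; rewrite /patch; case: ifP; rewrite ?lee_fin.
Qed.

End density.

(** * Moments from a Gaussian moment generating function *)

Section mgf.
Variable R : realType.

(** This is [1 - h <= expR (- h)] multiplied by [expR h]. *)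
Lemma expR_sub1_le (h : R) : expR h - 1 <= h * expR h.
Proof.
have := expR_ge1Dx (- h); rewrite expRN.
have e0 := expR_gt0 h; rewrite -(ler_pM2r e0) mulVf ?gt_eqF //; lra.
Qed.

(** Twice the hyperbolic sine. *)
Let sh (h : R) := expR h - expR (- h).

Lemma sh_bounds h : 0 <= h -> 2 * h * expR (- h) <= sh h <= 2 * h * expR h.
Proof.
move=> h0; rewrite /sh; have e0 := expR_gt0 h; have e1 := expR_gt0 (- h).
have eE : expR h * expR (- h) = 1 by rewrite -expRD subrr expR0.
have H := expR_ge1Dx (2 * h); have H' := expR_ge1Dx (- (2 * h)).
have E2 : expR (2 * h) = expR h * expR h by rewrite -expRD mulr_natl mulr2n.
have E2' : expR (- (2 * h)) = expR (- h) * expR (- h).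
  by rewrite -expRD -opprD mulr_natl mulr2n.
rewrite {}E2 in H; rewrite {}E2' in H'.
apply/andP; split.
  have := ler_wpM2r (ltW e1) H; nra.
have := ler_wpM2r (ltW e0) H'; nra.
Qed.

Lemma sqr_sh h : sh h ^+ 2 = expR (2 * h) + expR (- (2 * h)) - 2.
Proof.
have eE : expR h * expR (- h) = 1 by rewrite -expRD subrr expR0.
have -> : 2 * h = h + h by ring.
rewrite opprD !expRD /sh.
have -> : (2 : R) = 2 * (expR h * expR (- h)) by rewrite eE mulr1.
ring.
Qed.

(** The symmetric second difference quotient, with step [s], of the exponential with rate [y] at 0.
    Its expectation is read off the generating function, and it tends to [y ^+ 2]. *)
Definition dquot (s y : R) : R := (expR (s * y) + expR (- (s * y)) - 2) / s ^+ 2.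

Lemma dquotE s y : dquot s y = (sh (s * y / 2) / s) ^+ 2.
Proof. rewrite /dquot expr_div_n sqr_sh.
by have -> : 2 * (s * y / 2) = s * y by field. Qed.

Lemma dquot_ge0 s y : 0 <= dquot s y.
Proof. by rewrite dquotE sqr_ge0. Qed.

(** Duplication formula: [sh (2 * h)] is [sh h] times [expR h + expR (- h)], a factor at least 2.
    Along dyadic steps [dquot 1] is therefore a dominating function. *)
Lemma dquot_half s y : s != 0 -> dquot (s / 2) y <= dquot s y.
Proof.
move=> s0; rewrite !dquotE.
set h := s / 2 * y / 2; have -> : s * y / 2 = h + h by rewrite /h; field.
have eE : expR h * expR (- h) = 1 by rewrite -expRD subrr expR0.
have shE : sh (h + h) = sh h * (expR h + expR (- h)).
  by rewrite /sh opprD !expRD; ring.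
have H2 : 2 <= expR h + expR (- h).
  by have := expR_ge1Dx h; have := expR_ge1Dx (- h); lra.
have -> : sh h / (s / 2) = sh h * 2 / s by field.
rewrite shE !expr_div_n !exprMn ler_wpM2r ?invr_ge0 ?sqr_ge0 //.
by rewrite ler_wpM2l ?sqr_ge0 // !expr2; nra.
Qed.

(** The quotient is even in [y], so this is the square of [sh_bounds] at half of [s] times the
    absolute value of [y]. *)
Lemma dquot_bounds s y : 0 < s ->
  y ^+ 2 * expR (- (s * `|y|)) <= dquot s y <= y ^+ 2 * expR (s * `|y|).
Proof.
move=> s0.
have -> : dquot s y = dquot s `|y|.
  case: (ger0P y) => // _; rewrite /dquot mulrN opprK; congr (_ / _); ring.
rewrite -(real_normK (num_real y)).
have := normr_ge0 y; move: `|y| => {}y y0.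
set h := s * y / 2; have h0 : 0 <= h by rewrite /h; nra.
have E1 t : expR (h * t) ^+ 2 = expR (s * y * t).
  by rewrite expr2 -expRD; congr expR; rewrite /h; field.
have yE : y ^+ 2 = (2 * h / s) ^+ 2.
  by congr (_ ^+ 2); rewrite /h; field; rewrite gt_eqF.
have := E1 1; rewrite !mulr1 => E2; have := E1 (-1); rewrite !mulrN1 => E3.
rewrite dquotE -/h -E2 -E3 yE -!exprMn.
have si : 0 <= s^-1 by rewrite invr_ge0 ltW.
have e0 := expR_gt0 h; have e1 := expR_gt0 (- h).
have /andP[b1 b2] := sh_bounds h0.
have -> : 2 * h / s * expR (- h) = 2 * h * expR (- h) / s by ring.
have -> : 2 * h / s * expR h = 2 * h * expR h / s by ring.
have shp : 0 <= sh h by apply: le_trans b1; rewrite !mulr_ge0 // ltW.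
have c0 : 0 <= 2 * h * expR (- h) by rewrite !mulr_ge0 // ltW.
have c1 : 0 <= 2 * h * expR h by rewrite !mulr_ge0 // ltW.
by apply/andP; split;
  (apply: lerXn2r; [exact: mulr_ge0 | exact: mulr_ge0 | exact: ler_wpM2r]).
Qed.

Lemma half_cvg0 : (2^-1 ^+ k : R) @[k --> \oo] --> (0 : R).
Proof. by apply: cvg_expr; rewrite gtr0_norm ?invr_gt0 // invf_lt1 ?ltr1n. Qed.

Lemma expR_half_cvg (c : R) : expR (2^-1 ^+ k * c) @[k --> \oo] --> (1 : R).
Proof.
rewrite -[X in _ --> X]expR0; apply: continuous_cvg; first exact: continuous_expR.
by rewrite -[X in _ --> X](mul0r c); apply: cvgM; [exact: half_cvg0|exact: cvg_cst].
Qed.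

Lemma dquot_half_cvg (y : R) : dquot (2^-1 ^+ k) y @[k --> \oo] --> y ^+ 2.
Proof.
apply: (@squeeze_cvgr _ _ _ _ (fun k => y ^+ 2 * expR (2^-1 ^+ k * - `|y|))
  (fun k => y ^+ 2 * expR (2^-1 ^+ k * `|y|))).
- by apply: nearW => k; rewrite mulrN dquot_bounds // exprn_gt0 // invr_gt0.
- by rewrite -[X in _ --> X]mulr1; apply: cvgM;
    [exact: cvg_cst|exact: expR_half_cvg].
- by rewrite -[X in _ --> X]mulr1; apply: cvgM;
    [exact: cvg_cst|exact: expR_half_cvg].
Qed.

Lemma dquot_le1 k (y : R) : dquot (2^-1 ^+ k) y <= dquot 1 y.
Proof.
elim: k => [|k IH]; first by rewrite expr0.
rewrite exprSr (le_trans _ IH) // dquot_half //.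
Qed.

(** With [h = s ^+ 2 * v / 2] this is [h <= expR h - 1 <= h * expR h], rescaled. *)
Lemma mgf_quot_bounds (v s : R) : 0 < s ->
  v <= (2 * expR (s ^+ 2 * v / 2) - 2) / s ^+ 2 <= v * expR (s ^+ 2 * v / 2).
Proof.
move=> s0; set h := s ^+ 2 * v / 2.
have vE : v = 2 * h / s ^+ 2 by rewrite /h; field; rewrite gt_eqF.
have H1 := expR_ge1Dx h; have H2 := expR_sub1_le h.
have si : 0 <= (s ^+ 2)^-1 by rewrite invr_ge0 sqr_ge0.
rewrite vE [X in _ && (_ <= X)](_ : _ = 2 * h * expR h / s ^+ 2); last by ring.
by rewrite !ler_wpM2r //; lra.
Qed.

Lemma mgf_quot_cvg (v : R) :
  (2 * expR ((2^-1 ^+ k) ^+ 2 * v / 2) - 2) / (2^-1 ^+ k) ^+ 2 @[k --> \oo]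
  --> v.
Proof.
apply: (@squeeze_cvgr _ _ _ _ (fun=> v)
    (fun k => v * expR (2^-1 ^+ k * (2^-1 ^+ k * v / 2)))).
- apply: nearW => k; have : 0 < 2^-1 ^+ k :> R by rewrite exprn_gt0.
  move: (_ ^+ k) => s s0; have -> : s * (s * v / 2) = s ^+ 2 * v / 2 by ring.
  exact: mgf_quot_bounds.
- exact: cvg_cst.
- rewrite -[X in _ --> X]mulr1; apply: cvgM; first exact: cvg_cst.
  rewrite -[X in _ --> X]expR0; apply: continuous_cvg.
    exact: continuous_expR.
  rewrite -[X in _ --> X](mul0r 0); apply: cvgM; first exact: half_cvg0.
  rewrite -[X in _ --> X](mul0r (v / 2)).
  under eq_fun do rewrite -mulrA.
  by apply: cvgM; [exact: half_cvg0|exact: cvg_cst].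
Qed.

(** * First and second moments of a variable with Gaussian generating function *)

Section probability.
Context d (T : measurableType d) (P : probability T R) (Y : T -> R) (v : R).
Hypothesis mY : measurable_fun setT Y.
Hypothesis mgfY : forall s : R,
  (\int[P]_t (expR (s * Y t))%:E = (expR (s ^+ 2 * v / 2))%:E)%E.

Let mdquot s : measurable_fun setT (fun t => dquot s (Y t)).
Proof.
have me r : measurable_fun setT (fun t => expR (r * Y t)).
  by apply: measurableT_comp => //; apply: measurable_funM.
rewrite /dquot; under eq_fun do rewrite -mulNr.
by apply: measurable_funM => //; apply: measurable_funB => //;
  apply: measurable_funD.
Qed.

Lemma integral_dquot s : 0 < s -> (\int[P]_t (dquot s (Y t))%:E =
  ((2 * expR (s ^+ 2 * v / 2) - 2) / s ^+ 2)%:E)%E.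
Proof.
move=> s0.
have me r : measurable_fun setT (fun t => (expR (r * Y t))%:E).
  apply/measurable_EFinP; apply: measurableT_comp => //.
  by apply: measurable_funM.
have si : 0 <= (s ^+ 2)^-1 by rewrite invr_ge0 sqr_ge0.
have c0 : 0 <= 2 / s ^+ 2 by rewrite mulr_ge0.
(* Moving the constant to the left keeps all integrands nonnegative, so additivity holds in the
   extended reals; finiteness of the integral then follows from that of the sum. *)
have : (\int[P]_t (dquot s (Y t))%:E + (2 / s ^+ 2)%:E =
    (2 * expR (s ^+ 2 * v / 2) / s ^+ 2)%:E)%E.
  have <- : (\int[P]_t (2 / s ^+ 2)%:E = (2 / s ^+ 2)%:E)%E.
    by rewrite integral_cst //= probability_setT mule1.
  rewrite -ge0_integralD //; last 2 first.
    - by move=> t _; rewrite lee_fin dquot_ge0.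
    - exact/measurable_EFinP.
  transitivity (\int[P]_t ((s ^+ 2)^-1%:E *
      ((expR (s * Y t))%:E + (expR (- s * Y t))%:E)))%E.
    apply: eq_integral => t _; rewrite -!EFinD -EFinM mulNr; congr (_%:E).
    by rewrite /dquot; ring.
  rewrite ge0_integralZl_EFin //; last first.
    - by apply: emeasurable_funD.
    - by move=> t _; rewrite adde_ge0 // lee_fin expR_ge0.
  rewrite ge0_integralD //; try by move=> t _; rewrite lee_fin expR_ge0.
  by rewrite !mgfY sqrrN -EFinD -EFinM; congr (_%:E); ring.
case: (integral _ _ _) => [r| |] //= [] rE.
by congr (_%:E); rewrite mulrBl -rE addrK.
Qed.

(** Dominated convergence along the steps [2^-1 ^+ k]; the expectations of the quotients converge to
    [v] by [mgf_quot_cvg]. *)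
Lemma mgf_second_moment :
  P.-integrable setT (fun t => (Y t ^+ 2)%:E) /\
  (\int[P]_t (Y t ^+ 2)%:E = v%:E)%E.
Proof.
have iq : P.-integrable setT (fun t => (dquot 1 (Y t))%:E).
  apply/integrableP; split; first exact/measurable_EFinP.
  under eq_integral do rewrite gee0_abs ?lee_fin ?dquot_ge0 //.
  by rewrite integral_dquot // ltry.
have := @dominated_convergence _ _ _ P setT measurableT
  (fun k t => (dquot (2^-1 ^+ k) (Y t))%:E) (fun t => (Y t ^+ 2)%:E)
  (fun t => (dquot 1 (Y t))%:E).
case=> //.
- by move=> k; exact/measurable_EFinP.
- by apply/measurable_EFinP; exact: measurable_funX.
- apply: aeW => t _; apply: cvg_EFin; first exact: nearW.
  exact: dquot_half_cvg.
- apply: aeW => t k _; rewrite gee0_abs ?lee_fin ?dquot_ge0 //.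
  exact: dquot_le1.
move=> iY _ cY; split=> //.
have cv : (\int[P]_t (dquot (2^-1 ^+ k) (Y t))%:E)%E @[k --> \oo] --> v%:E.
  under eq_fun do rewrite integral_dquot ?exprn_gt0 //.
  by apply: cvg_EFin; [exact: nearW | exact: mgf_quot_cvg].
exact: (cvg_unique _ cY cv).
Qed.

(** Integrating [1 + s * Y <= expR (s * Y)] bounds [1 + s * mu] by a function of [s] that is flat to
    first order at 0, which forces [mu = 0]. *)
Lemma mgf_mean :
  P.-integrable setT (fun t => (Y t)%:E) /\ (\int[P]_t (Y t)%:E = 0)%E.
Proof.
have [iY2 Y2E] := mgf_second_moment.
have iY : P.-integrable setT (fun t => (Y t)%:E).
  apply: (@le_integrable _ _ _ P _ measurableT _
    (fun t => 1%:E + (Y t ^+ 2)%:E)%E).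
  - exact/measurable_EFinP.
  - move=> t _; rewrite -EFinD !abse_EFin lee_fin (@ger0_norm _ (1 + _)).
      have := sqr_ge0 (`|Y t| - 1); rewrite sqrrB1 real_normK ?num_real //.
      by have := normr_ge0 (Y t); rewrite mulr2n; nra.
    by rewrite addr_ge0 ?sqr_ge0.
  - apply: integrableD => //; exact: finite_measure_integrable_cst.
have v0 : 0 <= v.
  by rewrite -lee_fin -Y2E; apply: integral_ge0 => t _; rewrite lee_fin sqr_ge0.
split => //.
have [mu muE] : exists mu, (\int[P]_t (Y t)%:E = mu%:E)%E.
  by exists (fine (\int[P]_t (Y t)%:E)%E); rewrite fineK // integrable_fin_num.
rewrite muE; congr (_%:E).
have tangent s : 1 + s * mu <= expR (s ^+ 2 * v / 2).
  rewrite -lee_fin -mgfY EFinD EFinM -muE.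
  rewrite -(@integralZl _ _ _ P) //.
  have -> : (1%:E = \int[P]_t 1%:E)%E.
    by rewrite integral_cst //= probability_setT mule1.
  rewrite -integralD //; last 2 first.
    - exact: finite_measure_integrable_cst.
    - exact: integrableZl.
  apply: le_integral => //.
  - apply: integrableD => //; first exact: finite_measure_integrable_cst.
    exact: integrableZl.
  - apply/integrableP; split.
      apply/measurable_EFinP; apply: measurableT_comp => //.
      by apply: measurable_funM.
    under eq_integral do rewrite gee0_abs ?lee_fin ?expR_ge0 //.
    by rewrite mgfY ltry.
  - by move=> t _; rewrite -EFinM -EFinD lee_fin expR_ge1Dx.
(* Only positive means need excluding: replacing [s] by [- s] turns the inequality for [mu] into the
   one for [- mu]. *)
suff mean0 (u : R) : (forall s, 1 + s * u <= expR (s ^+ 2 * v / 2)) -> u <= 0.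
  apply/eqP; rewrite eq_le mean0 //= -oppr_le0 mean0 // => s.
  by rewrite mulrN -mulNr -(sqrrN s).
move=> {}tangent; rewrite leNgt; apply/negP => u0.
(* Small enough that [s * (1 + v) < 1] and [s * v < u]. The first gives [h < 1 / 2] and
   [expR h <= 2], hence [s * u <= 2 * h = s * (s * v)], against the second. *)
pose s := u / ((1 + v) * (1 + u)).
have v1 : 0 < 1 + v by lra.
have u1 : 0 < 1 + u by lra.
have s0 : 0 < s by rewrite divr_gt0 // mulr_gt0.
have sE : s * ((1 + v) * (1 + u)) = u by rewrite divfK // gt_eqF // mulr_gt0.
have s1 : s * (1 + v) < 1 by nra.
have su : s * v < u by nra.
pose h := s ^+ 2 * v / 2.
have h1 : h < 1 / 2 by rewrite /h expr2; nra.
have h0 : 0 <= h by rewrite /h divr_ge0 // mulr_ge0 // sqr_ge0.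
have := tangent s; rewrite -/h => H.
have H2 := expR_sub1_le h.
have e1 : expR h <= 2.
  have := expR_gt0 h; nra.
have : s * u <= s * (s * v).
  have -> : s * (s * v) = 2 * h by rewrite /h; field.
  nra.
by rewrite ler_pM2l // leNgt su.
Qed.

End probability.
End mgf.

(** * Spectral decomposition of the Hamming scheme *)

Section krawtchouk_poly.
Variable R : realType.

Lemma coef_binomial (c : R) t l :
  ((1 + c *: 'X) ^+ t)`_l = c ^+ l * 'C(t, l)%:R.
Proof.
elim: t l => [|t IH] l.
  by rewrite expr0 coef1 bin0n; case: l => [|l]; rewrite ?mul1r ?expr0 //= mulr0.
rewrite exprS mulrDl mul1r coefD -scalerAl coefZ coefXM IH.
case: l => [|l]; first by rewrite !bin0 mulr0 addr0.
by rewrite /= IH binS natrD exprS; ring.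
Qed.

(** Outside the original range one of the two binomials vanishes; the full range makes the sum a
    convolution. *)
Lemma krawtchouk_full (d n j t : nat) : (j <= d)%N -> (t <= d)%N ->
  krawtchouk R d n j t = \sum_(0 <= l < j.+1)
    (-1) ^+ l * n.-1%:R ^+ (j - l) * 'C(t, l)%:R * 'C(d - t, j - l)%:R.
Proof.
move=> jd td; rewrite /krawtchouk.
have le1 : (j + t - d <= (minn j t).+1)%N by lia.
rewrite [RHS](@big_cat_nat _ _ _ (j + t - d)) //=; last first.
  by rewrite (leq_trans le1) // ltnS geq_minl.
rewrite [X in _ = X + _]big1_seq ?add0r; last first.
  move=> l; rewrite mem_index_iota => /andP[_ hl].
  rewrite (@bin_small (d - t)) ?mulr0 //.
  by lia.
rewrite [RHS](@big_cat_nat _ _ _ (minn j t).+1) //=; last first.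
  by rewrite ltnS geq_minl.
rewrite [X in _ = _ + X]big1_seq ?addr0 // => l.
rewrite mem_index_iota => /andP[_ /andP[hl1 hl2]].
rewrite (@bin_small t) ?mulr0 ?mul0r //.
by move: hl1; rewrite gtn_min ltnNge -ltnS hl2.
Qed.

Lemma coef_krawtchouk (d n j t : nat) : (j <= d)%N -> (t <= d)%N ->
  ((1 - 'X) ^+ t * (1 + n.-1%:R *: 'X) ^+ (d - t) : {poly R})`_j =
  krawtchouk R d n j t.
Proof.
move=> jd td; rewrite krawtchouk_full // coefM big_mkord.
apply: eq_bigr => l _.
by rewrite -scaleN1r !coef_binomial; ring.
Qed.

(** By Vandermonde, [kappa] is the same sum with signs dropped and each power of [n - 1] raised to
    [j]. *)
Lemma krawtchouk_le (d n j t : nat) : (2 <= n)%N -> (j <= d)%N ->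
  (t <= d)%N -> `|krawtchouk R d n j t| <= kappa R d n j.
Proof.
move=> n2 jd td; rewrite krawtchouk_full // (le_trans (ler_norm_sum _ _ _)) //.
have -> : kappa R d n j = \sum_(0 <= l < j.+1)
    (n.-1%:R ^+ j * ('C(t, l) * 'C(d - t, j - l))%:R).
  rewrite -mulr_sumr -natr_sum big_mkord binomial.Vandermonde subnKC // /kappa.
  by rewrite natrM natrX mulrC.
rewrite ler_sum_nat // => l /andP[_ lj].
rewrite !normrM normrX normrN1 expr1n mul1r normrX !normr_nat natrM mulrA.
rewrite -!mulrA ler_wpM2r ?mulr_ge0 ?ler0n // ler_weXn2l ?leq_subr //.
by rewrite ler1n -ltnS prednK // ltnW.
Qed.

End krawtchouk_poly.

(** * Projection kernels and their eigenvalues under the distance matrices *)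

Section projections.
Variables (R : realType) (d n : nat).
Hypothesis n2 : (2 <= n)%N.
Local Notation X := (config d n).

Definition eigenproj (T : {set 'I_d}) (x y : X) : R :=
  \prod_(i < d) (if i \in T then (x i == y i)%:R - n%:R^-1 else n%:R^-1).

Lemma eigenproj_sym T x y : eigenproj T x y = eigenproj T y x.
Proof. by apply: eq_bigr => i _; rewrite (eq_sym (x i)). Qed.

(** Expansion over [T] of the product over coordinates of [(I - 1/n) + 1/n]. *)
Lemma sum_eigenproj x y : \sum_(T : {set 'I_d}) eigenproj T x y = (x == y)%:R.
Proof.
rewrite -(bigA_distr _ _ (fun i => (x i == y i)%:R - n%:R^-1) (fun=> n%:R^-1)).
rewrite /= (eq_bigr (fun i => (x i == y i)%:R)) => [|i _]; last by rewrite subrK.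
have [->|xy] := eqVneq x y; first by rewrite big1 // => i _; rewrite eqxx.
have [i xyi] : exists i, x i != y i.
  apply/existsP; rewrite -negb_forall; apply: contra xy => /forallP xy.
  by apply/eqP/ffunP => i; apply/eqP/xy.
by rewrite (bigD1 i) //= (negbTE xyi) mul0r.
Qed.

(** One coordinate: the matrix with 1 on and [u] off the diagonal has eigenvalue [1 + (n - 1) u] on
    constants and [1 - u] on vectors of sum zero. *)
Lemma eigenproj_site (u : {poly R}) (b : bool) (a c : 'I_n) :
  \sum_(e : 'I_n) (if a != e then u else 1) *
     (if b then (e == c)%:R - n%:R^-1 else n%:R^-1)%:P
  = (if b then 1 - u else 1 + n.-1%:R *: u) *
     (if b then (a == c)%:R - n%:R^-1 else n%:R^-1)%:P.
Proof.
have n0 : n%:R != 0 :> R by rewrite pnatr_eq0 -lt0n ltnW.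
have eqn : n.-1%:R = n%:R - 1 :> R by rewrite -subn1 natrB // ltnW.
have S0 : \sum_(e : 'I_n) (if a != e then u else 1) = 1 + n.-1%:R *: u.
  rewrite (bigD1 a) //= eqxx; congr (_ + _).
  rewrite (eq_bigr (fun=> u)) => [|e]; last by rewrite eq_sym => ->.
  rewrite sumr_const (_ : #|_| = n.-1) ?scaler_nat //.
  by have := cardC1 a; rewrite card_ord.
case: b; last by rewrite -mulr_suml S0.
under eq_bigr do rewrite polyCB mulrBr.
rewrite sumrB -mulr_suml S0 (bigD1 c) //= eqxx mulr1 big1 ?addr0; last first.
  by move=> e /negbTE ->; rewrite mulr0.
have nP : n%:R%:P * (n%:R^-1)%:P = 1 :> {poly R} by rewrite -polyCM divff.
(* [ring] treats [n] and its inverse as independent constants; their relation is supplied as an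
   explicit multiple. *)
have defect p q : p - q = u * (1 - n%:R%:P * (n%:R^-1)%:P) -> p = q.
  by rewrite nP subrr mulr0 => /eqP; rewrite subr_eq0 => /eqP.
by case: eqVneq => _ /=; apply: defect;
  rewrite ?sub0r -mul_polyC eqn ?polyCN !polyCB; ring.
Qed.

Lemma expr_hdist (A : comPzRingType) (u : A) (x y : X) :
  u ^+ hdist x y = \prod_(i < d) (if x i != y i then u else 1).
Proof. by rewrite -big_mkcond prodr_const. Qed.

Lemma prod_if_set (A : comPzRingType) (u v : A) (T : {set 'I_d}) :
  \prod_(i < d) (if i \in T then u else v) = u ^+ #|T| * v ^+ (d - #|T|).
Proof.
rewrite (bigID (mem T)) /=; congr (_ * _).
  rewrite (eq_bigr (fun=> u)) ?prodr_const // => i ->; exact.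
rewrite (eq_bigr (fun=> v)) => [|i /negbTE ->//].
rewrite prodr_const -[X in (X - _)%N]card_ord -(cardC T) addKn.
by congr (_ ^+ _); apply: eq_card.
Qed.

(** The sum over configurations factors over coordinates, each factor being an instance of
    [eigenproj_site]. *)
Lemma gen_eigenproj (u : {poly R}) T (x z : X) :
  \sum_(y : X) u ^+ hdist x y * (eigenproj T y z)%:P =
  (1 - u) ^+ #|T| * (1 + n.-1%:R *: u) ^+ (d - #|T|) * (eigenproj T x z)%:P.
Proof.
rewrite -prod_if_set rmorph_prod -big_split /=.
under [RHS]eq_bigr do rewrite -eigenproj_site.
rewrite bigA_distr_bigA /=; apply: eq_bigr => y _.
by rewrite expr_hdist rmorph_prod -big_split.
Qed.

Lemma hdistC (x y : X) : hdist x y = hdist y x.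
Proof. by apply: eq_card => i; rewrite !inE eq_sym. Qed.

Lemma hdist_eq0 (x y : X) : (hdist x y == 0%N) = (x == y).
Proof.
rewrite -[LHS]/(pred0b [pred i | x i != y i]); apply/pred0P/eqP => [xy|-> i].
  by apply/ffunP => i; apply/eqP; have /negbFE := xy i.
by rewrite /= eqxx.
Qed.

Lemma card_set_ord_le (T : {set 'I_d}) : (#|T| <= d)%N.
Proof. by rewrite -[X in (_ <= X)%N]card_ord max_card. Qed.

(** Coefficient of degree [j] in [gen_eigenproj] at [u = 'X]. *)
Lemma shell_eigenproj j T (x z : X) : (j <= d)%N ->
  \sum_(y | hdist x y == j) eigenproj T y z =
  krawtchouk R d n j #|T| * eigenproj T x z.
Proof.
move=> jd; rewrite -coef_krawtchouk ?card_set_ord_le // -coefMC -gen_eigenproj.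
rewrite coef_sum big_mkcond; apply: eq_bigr => y _.
by rewrite coefMC coefXn eq_sym; case: eqP; rewrite ?mul1r ?mul0r.
Qed.

Lemma krawtchouk0 j : krawtchouk R d n j 0 = kappa R d n j.
Proof.
rewrite /krawtchouk /kappa minn0.
have [jd|dj] := leqP j d; last first.
  by rewrite bin_small // mul0n big_geq // addn0 subn_gt0.
rewrite addn0 (eqP jd) big_nat1 expr0 mul1r subn0 bin0 mulr1 subn0.
by rewrite natrM natrX mulrC.
Qed.

Lemma eigenproj0 (x z : X) : eigenproj finset.set0 x z = n%:R^-1 ^+ d.
Proof.
rewrite /eigenproj (eq_bigr (fun=> n%:R^-1)) => [|i _]; last by rewrite inE.
by rewrite prodr_const card_ord.
Qed.

(** The kernel of the empty set is constant, so its eigenvalue is the row sum of the distance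
    matrix. *)
Lemma card_shell j (x : X) : (j <= d)%N ->
  #|[pred y : X | hdist x y == j]|%:R = kappa R d n j.
Proof.
move=> jd; have nd0 : n%:R^-1 ^+ d != 0 :> R.
  by rewrite expf_neq0 // invr_neq0 // pnatr_eq0 -lt0n ltnW.
have := shell_eigenproj finset.set0 x x jd.
rewrite cards0 krawtchouk0; under eq_bigr do rewrite eigenproj0.
by rewrite eigenproj0 sumr_const -[X in X = _]mulr_natl => /(mulIf nd0).
Qed.

Lemma kappa_gt0 j : (j <= d)%N -> 0 < kappa R d n j.
Proof.
move=> jd; rewrite /kappa ltr0n muln_gt0 bin_gt0 jd expn_gt0.
by rewrite -ltnS prednK // ?n2 // ltnW.
Qed.

(** * The precision operator, its inverse and the Hamiltonian *)

Variables (J : nat -> R) (m : R).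
Local Notation w := (shell_weight d n J).
Local Notation lam := (hamming_eigenvalue d n J).

Definition interaction (f : X -> R) (x : X) : R :=
  \sum_(0 <= j < d.+1)
    w j / kappa R d n j * \sum_(y | hdist x y == j) f y.

Definition precision (f : X -> R) (x : X) : R :=
  (1 + m ^+ 2) * f x - interaction f x.

Lemma precision_eigenproj T (x z : X) :
  precision (eigenproj T ^~ z) x = (1 + m ^+ 2 - lam #|T|) * eigenproj T x z.
Proof.
rewrite /precision mulrBl; congr (_ - _); rewrite mulr_suml.
by apply: eq_big_nat => j jd; rewrite shell_eigenproj // mulrA.
Qed.

Lemma precision_sum (I : finType) (c : I -> R) (f : I -> X -> R) x :
  precision (fun y => \sum_i c i * f i y) x = \sum_i c i * precision (f i) x.
Proof.
rewrite /precision /interaction.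
under [RHS]eq_bigr do rewrite mulrBr mulrCA mulr_sumr.
rewrite sumrB -mulr_sumr; congr (_ - _); rewrite exchange_big /=.
apply: eq_bigr => j _; rewrite exchange_big /= mulr_sumr.
by apply: eq_bigr => i _; rewrite -mulr_sumr mulrCA.
Qed.

Definition green (x z : X) : R :=
  \sum_(T : {set 'I_d}) (1 + m ^+ 2 - lam #|T|)^-1 * eigenproj T x z.

Lemma green_sym x z : green x z = green z x.
Proof. by apply: eq_bigr => T _; rewrite eigenproj_sym. Qed.

(** Each eigenvalue cancels its coefficient in [green], leaving the resolution of the identity. *)
Lemma precision_green (a : X -> R) x :
  (forall t, (t <= d)%N -> 1 + m ^+ 2 - lam t != 0) ->
  precision (fun y => \sum_z a z * green y z) x = a x.
Proof.
move=> mass_gap.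
rewrite precision_sum (bigD1 x) //= [X in _ + X]big1 => [|z zx].
  rewrite precision_sum (eq_bigr (fun T => eigenproj T x x)) => [|T _].
    by rewrite sum_eigenproj eqxx mulr1 addr0.
  by rewrite precision_eigenproj mulKf // mass_gap // card_set_ord_le.
rewrite precision_sum (eq_bigr (fun T => eigenproj T x z)) => [|T _].
  by rewrite sum_eigenproj eq_sym (negbTE zx) mulr0.
by rewrite precision_eigenproj mulKf // mass_gap // card_set_ord_le.
Qed.

(** Self-adjointness, from the symmetry of the Hamming distance. *)
Lemma precisionC (f g : X -> R) :
  \sum_x f x * precision g x = \sum_x g x * precision f x.
Proof.
rewrite /precision /interaction.
under eq_bigr do rewrite mulrBr mulr_sumr.
under [RHS]eq_bigr do rewrite mulrBr mulr_sumr.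
rewrite !sumrB; congr (_ - _); first by apply: eq_bigr => x _; ring.
rewrite exchange_big [RHS]exchange_big /=; apply: eq_bigr => j _.
under eq_bigr do rewrite mulrCA mulr_sumr.
under [RHS]eq_bigr do rewrite mulrCA mulr_sumr.
rewrite -!mulr_sumr; congr (_ * _).
under eq_bigr do rewrite big_mkcond.
rewrite exchange_big /=; apply: eq_bigr => y _.
rewrite [RHS]big_mkcond; apply: eq_bigr => x _.
by rewrite hdistC; case: ifP => // _; rewrite mulrC.
Qed.

(** Over ordered pairs, the squares in each shell contribute [2 * kappa] times the squared norm and
    the cross terms the distance matrix, so the factor 1/4 becomes 1/2. *)
Lemma hamiltonianE (f : X -> R) :
  hamiltonian J m f = 2^-1 * \sum_x f x * precision f x.
Proof.
have pairs j : (j <= d)%N ->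
    \sum_(p : X * X | hdist p.1 p.2 == j) (f p.1 - f p.2) ^+ 2 =
    2 * kappa R d n j * (\sum_x f x ^+ 2)
    - 2 * \sum_x f x * \sum_(y | hdist x y == j) f y.
  move=> jd.
  rewrite -(pair_big_dep predT (fun x y => hdist x y == j)
    (fun x y => (f x - f y) ^+ 2)) /=.
  have half : \sum_x \sum_(y | hdist x y == j) f x ^+ 2 =
      kappa R d n j * \sum_x f x ^+ 2.
    rewrite mulr_sumr; apply: eq_bigr => x _.
    by rewrite sumr_const -(card_shell x jd) mulr_natl.
  have half' : \sum_x \sum_(y | hdist x y == j) f y ^+ 2 =
      kappa R d n j * \sum_x f x ^+ 2.
    rewrite -half; under eq_bigr do rewrite big_mkcond.
    rewrite exchange_big /=; apply: eq_bigr => x _.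
    by rewrite [RHS]big_mkcond; apply: eq_bigr => y _; rewrite hdistC.
  have -> : 2 * kappa R d n j * (\sum_x f x ^+ 2) =
      kappa R d n j * (\sum_x f x ^+ 2) + kappa R d n j * (\sum_x f x ^+ 2).
    by ring.
  rewrite -{1}half -half' mulr_sumr -big_split -sumrB /=.
  apply: eq_bigr => x _; rewrite mulrA mulr_sumr -big_split -sumrB /=.
  by apply: eq_bigr => y _; ring.
rewrite /hamiltonian /precision /interaction.
set S2 := \sum_x f x ^+ 2.
pose S j := \sum_x f x * \sum_(y | hdist x y == j) f y.
rewrite (eq_big_nat _ _ (F2 := fun j => 2 * (kappa R d n j * J j) * S2
    - 2 * (J j * S j))) => [|j /andP[_ jd]]; last first.
  by rewrite pairs // -/S2 -/(S j); ring.
have -> : \sum_x f x * ((1 + m ^+ 2) * f x - \sum_(0 <= j < d.+1)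
    w j / kappa R d n j * \sum_(y | hdist x y == j) f y) =
    (1 + m ^+ 2) * S2 - \sum_(0 <= j < d.+1) w j / kappa R d n j * S j.
  under eq_bigr do rewrite mulrBr mulr_sumr.
  rewrite sumrB; congr (_ - _).
    by rewrite mulr_sumr; apply: eq_bigr => x _; ring.
  rewrite exchange_big /=; apply: eq_bigr => j _.
  by rewrite mulr_sumr; apply: eq_bigr => x _; rewrite mulrCA.
(* The term [j = 0] is split off: its weight, 1 minus the others, turns the 1 of [1 + m ^+ 2] into
   the diagonal part of the interaction. *)
rewrite sumrB -mulr_suml -!mulr_sumr [in RHS]big_ltn //.
have -> : S 0%N = S2.
  apply: eq_bigr => x _; rewrite (big_pred1 x) // => y.
  by rewrite /= hdist_eq0 eq_sym.
rewrite [X in w 0 / _ * _ + X](eq_big_nat _ _ (F2 := fun j => J j * S j))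
  => [|j /andP[j0 jd]]; last first.
  rewrite /shell_weight gtn_eqF // [X in X / _]mulrC mulfK //.
  by rewrite gt_eqF // kappa_gt0.
have -> : kappa R d n 0 = 1 by rewrite /kappa bin0 expn0.
rewrite {1}/shell_weight eqxx divr1.
by field.
Qed.

Lemma hamiltonian_shift (f b : X -> R) :
  hamiltonian J m (fun x => f x - b x) =
  hamiltonian J m f - \sum_x precision b x * f x + hamiltonian J m b.
Proof.
have pB x : precision (fun y => f y - b y) x = precision f x - precision b x.
  rewrite /precision /interaction.
  under eq_bigr do rewrite sumrB mulrBr.
  by rewrite sumrB; ring.
rewrite !hamiltonianE.
have -> : \sum_x (f x - b x) * precision (fun y => f y - b y) x =
    \sum_x f x * precision f x - \sum_x precision b x * f x
    - \sum_x b x * precision f x + \sum_x b x * precision b x.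
  rewrite -!sumrN -!big_split /=; apply: eq_bigr => x _; rewrite pB; ring.
rewrite (precisionC b f).
under [X in _ - X]eq_bigr do rewrite mulrC.
by field.
Qed.

End projections.

(** * Covariance of the free field *)

Section gff.
Context (R : realType) (d n : nat) (J : nat -> R) (m beta : R).
Context (disp : measure_display) (T : measurableType disp) (P : probability T R).
Variable g : config d n -> {RV P >-> R}.
Hypothesis n2 : (2 <= n)%N.
Hypothesis beta0 : 0 < beta.
Hypothesis gap : forall t, (t <= d)%N ->
  1 + m ^+ 2 - hamming_eigenvalue d n J t != 0.
Hypothesis hg : is_gff J m beta g.
Local Notation N := #|{: config d n}|.
Local Notation G := (green (d := d) (n := n) J m).

Lemma measurable_hamiltonian :
  measurable_fun setT
    (fun t : Rtuple R N => hamiltonian J m (field_of_tuple t)).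
Proof.
have mf (x : config d n) :
    measurable_fun setT (fun t : Rtuple R N => field_of_tuple t x).
  exact: measurable_tnth.
apply: measurable_funD.
  apply: measurable_funM => //; apply: measurable_sum => i.
  apply: measurable_funM => //.
  rewrite (_ : (fun t => _) = (fun t : Rtuple R N =>
    \sum_(p : config d n * config d n) if hdist p.1 p.2 == i
      then (field_of_tuple t p.1 - field_of_tuple t p.2) ^+ 2 else 0)); last first.
    by apply/funext => t; rewrite [LHS]big_mkcond.
  apply: measurable_sum => p; case: (_ == i) => //.
  by apply: measurable_funX; apply: measurable_funB.
by apply: measurable_funM => //; apply: measurable_sum => x; apply: measurable_funX.
Qed.

Lemma gff_mgf (a : config d n -> R) :
  (\int[P]_w (expR (\sum_x a x * g x w))%:E =
   (expR ((\sum_x \sum_z a x * a z * G x z) / beta / 2))%:E)%E.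
Proof.
have [c hc] := hg.
pose X w : Rtuple R N := tuple_of_field (fun x => g x w).
have fX w x : field_of_tuple (X w) x = g x w.
  by rewrite /field_of_tuple tnth_mktuple enum_rankK.
have mX : measurable_fun setT X.
  apply/measurable_fun_tnthP => i.
  rewrite (_ : _ \o _ = g (enum_val i)).
    exact: (@measurable_funP _ _ _ _ setT (g (enum_val i))).
  by apply/funext => w; rewrite /= tnth_mktuple.
pose W (t : Rtuple R N) := expR (- (beta * hamiltonian J m (field_of_tuple t))).
have mW : measurable_fun setT W.
  apply: measurableT_comp => //; apply: measurableT_comp => //.
  by apply: measurable_funM => //; exact: measurable_hamiltonian.
have W0 t : 0 <= W t by exact: expR_ge0.
(* Total mass 1 is the only information used about [c] and the partition function. *)
have total : (c%:E * \int[lebesgue_tuple R N]_t (W t)%:E = 1)%E.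
  by rewrite -hc //= -(@probability_setT _ _ _ P); congr (P _).
have Z0 : (0 <= \int[lebesgue_tuple R N]_t (W t)%:E)%E.
  by apply: integral_ge0 => t _; rewrite lee_fin.
have c0 : 0 <= c.
  rewrite leNgt; apply/negP => c0.
  have : (c%:E * \int[lebesgue_tuple R N]_t (W t)%:E <= 0)%E.
    by rewrite mule_le0_ge0 // lee_fin ltW.
  by rewrite total lee_fin ler10.
pose L (t : Rtuple R N) := expR (\sum_x a x * field_of_tuple t x).
have mL : measurable_fun setT L.
  apply: measurableT_comp => //; apply: measurable_sum => x.
  by apply: measurable_funM => //; exact: measurable_tnth.
transitivity (\int[P]_w ((EFin \o L) \o X) w)%E.
  apply: eq_integral => w _; rewrite /= /L; congr (expR _)%:E.
  by apply: eq_bigr => x _; rewrite fX.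
rewrite -[LHS](@ge0_integral_pushforward _ _ _ _ _ _ mX P setT (EFin \o L)) //;
    last 2 first.
  - exact/measurable_EFinP.
  - by move=> t _; rewrite lee_fin expR_ge0.
rewrite (@ge0_integral_density _ _ _ (lebesgue_tuple R N) _
  (fun t => c * W t)); last 5 first.
- exact: measurable_funM.
- by move=> t; rewrite mulr_ge0.
- move=> A mA; rewrite [LHS]hc //.
  under [RHS]eq_integral do rewrite EFinM.
  rewrite ge0_integralZl_EFin //; first by move=> t _; rewrite lee_fin.
  exact/measurable_EFinP/measurable_funTS.
- exact/measurable_EFinP.
- by move=> t; rewrite lee_fin expR_ge0.
(* The centre of the completed square: [precision] maps [b] to [a / beta], so the cross term of
   [beta * H] at the shifted field is exactly the pairing with [a]. *)
pose b x := \sum_z beta^-1 * a z * G x z.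
have Pb x : precision J m b x = beta^-1 * a x.
  exact: (precision_green n2 (fun z => beta^-1 * a z)).
have Hb : beta * hamiltonian J m b = (\sum_x \sum_z a x * a z * G x z) / beta / 2.
  have b0 : beta != 0 by rewrite gt_eqF.
  rewrite hamiltonianE // mulr_suml [RHS]mulr_suml !mulr_sumr.
  apply: eq_bigr => x _; rewrite Pb /b !mulr_suml !mulr_sumr.
  by apply: eq_bigr => z _; field.
pose s (i : 'I_N) := - b (enum_val i).
have LW t : L t * (c * W t) =
    expR (beta * hamiltonian J m b) * (c * W (tuple_shift s t)).
  rewrite mulrCA [RHS]mulrCA -!expRD; congr (_ * expR _).
  have -> : field_of_tuple (tuple_shift s t) =
      (fun x => field_of_tuple t x - b x).
    by apply/funext => x; rewrite /field_of_tuple tnth_mktuple /s enum_rankK.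
  rewrite hamiltonian_shift //.
  have -> : \sum_x a x * field_of_tuple t x =
      beta * \sum_x precision J m b x * field_of_tuple t x.
    rewrite mulr_sumr; apply: eq_bigr => x _.
    by rewrite Pb !mulrA divff ?mul1r // gt_eqF.
  by ring.
transitivity (\int[lebesgue_tuple R N]_t ((expR (beta * hamiltonian J m b))%:E *
    (c%:E * (W (tuple_shift s t))%:E)))%E.
  by apply: eq_integral => t _; rewrite -!EFinM -LW.
have mWs : measurable_fun setT (fun t => W (tuple_shift s t)).
  by apply: measurableT_comp => //; exact: measurable_tuple_shift.
rewrite ge0_integralZl_EFin ?expR_ge0 //; last 2 first.
- by move=> t _; rewrite mule_ge0 // lee_fin.
- by apply: emeasurable_funM => //; exact/measurable_EFinP.
rewrite ge0_integralZl_EFin //; last 2 first.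
- by move=> t _; rewrite lee_fin.
- exact/measurable_EFinP.
rewrite (ge0_integral_tuple_shift _ (f := EFin \o W)) //.
  by rewrite total mule1 Hb.
exact/measurable_EFinP.
Qed.

(** Polarization: the second moments of [g x + g x'] and [g x - g x'] come from the generating
    function, and the means vanish. *)
Lemma gff_covariance (x x' : config d n) :
  covariance P (g x) (g x') = (G x x' / beta)%:E.
Proof.
pose S (e s : R) (w : T) := s * g x w + e * (s * g x' w).
have mS e : measurable_fun setT (S e 1).
  apply: measurable_funD; apply: measurable_funM => //;
    try exact: (@measurable_funP _ _ _ _ setT (g _)).
  apply: measurable_funM => //; exact: (@measurable_funP _ _ _ _ setT (g _)).
pose v (e : R) := (G x x + e ^+ 2 * G x' x' + 2 * e * G x x') / beta.
have mgf e s : (\int[P]_w (expR (s * S e 1 w))%:E =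
    (expR (s ^+ 2 * v e / 2))%:E)%E.
  (* Adding the two indicators also covers the case [x = x']. *)
  pose a y := s * ((x == y)%:R + e * (x' == y)%:R).
  have suma (h : config d n -> R) : \sum_y a y * h y = s * (h x + e * h x').
    have pick z : \sum_y (z == y)%:R * h y = h z.
      rewrite (bigD1 z) //= eqxx mul1r big1 ?addr0 // => y yz.
      by rewrite eq_sym (negbTE yz) mul0r.
    rewrite -(pick x) -(pick x') mulr_sumr -big_split mulr_sumr /=.
    by apply: eq_bigr => y _; rewrite /a; ring.
  have := gff_mgf a.
  under eq_integral do rewrite suma.
  under [in X in _ = X -> _]eq_bigr => y _.
    under eq_bigr do rewrite -mulrA.
    rewrite -mulr_sumr suma.
    over.
  rewrite suma (green_sym _ _ x' x) => H.
  rewrite [RHS](_ : _ = (expR (s * (s * (G x x + e * G x x') +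
      e * (s * (G x x' + e * G x' x'))) / beta / 2))%:E).
    rewrite -H; apply: eq_integral => w _; congr (expR _)%:E; rewrite /S; ring.
  by congr (expR _)%:E; rewrite /v; ring.
have mg y : measurable_fun setT (g y).
  exact: (@measurable_funP _ _ _ _ setT (g y)).
have mean y : P.-integrable setT (EFin \o g y) /\ (\int[P]_w (g y w)%:E = 0)%E.
  have := @mgf_mean _ _ _ P (g y) (G y y / beta) (mg y); apply => s.
  pose a z := s * (y == z)%:R.
  have suma (h : config d n -> R) : \sum_z a z * h z = s * h y.
    rewrite (bigD1 y) //= /a eqxx mulr1 big1 ?addr0 // => z yz.
    by rewrite eq_sym (negbTE yz) mulr0 mul0r.
  have := gff_mgf a.
  under eq_integral do rewrite suma.
  under [in X in _ = X -> _]eq_bigr => z _.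
    under eq_bigr do rewrite -mulrA.
    rewrite -mulr_sumr suma.
    over.
  by rewrite suma => ->; congr (expR _)%:E; ring.
have [ip Ep] := mgf_second_moment (mS 1) (mgf 1).
have [im Em] := mgf_second_moment (mS (-1)) (mgf (-1)).
have prodE w : (g x w * g x' w)%:E =
    (4^-1%:E * ((S 1 1 w ^+ 2)%:E - (S (-1) 1 w ^+ 2)%:E))%E.
  by rewrite -EFinB -EFinM /S; congr (_%:E); field.
have iD : P.-integrable setT
    (fun w => (S 1 1 w ^+ 2)%:E - (S (-1) 1 w ^+ 2)%:E)%E.
  exact: integrableB.
have iXY : P.-integrable setT (EFin \o (g x * g x')).
  apply: (eq_integrable measurableT) (integrableZl measurableT 4^-1 iD).
  by move=> w _; rewrite -prodE.
have [i1 E1] := mean x; have [i2 E2] := mean x'.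
rewrite covarianceE; [|exact/Lfun1_integrable..].
rewrite !expectation_def E1 mul0e sube0.
under eq_integral => w _ do rewrite -[((g x * g x') w)%R]/(g x w * g x' w) prodE.
rewrite integralZl // integralB // Ep Em -EFinB -EFinM /v; congr (_%:E).
by field; rewrite gt_eqF.
Qed.

End gff.

(** * Asymptotics *)

Section rates.
Variable R : realType.

Definition rate (u : nat -> R) (l : R) :=
  exists K : R, \forall n \near \oo, `|u n - l| <= K / n%:R.

(** The limit stays existential so that limits of compound expressions need not be written out; it
    is identified once, by uniqueness, in the final proof. *)
Definition has_rate (u : nat -> R) := exists l, rate u l.

Lemma rate_pos u l : rate u l ->
  exists2 K : R, 0 <= K & \forall n \near \oo, `|u n - l| <= K / n%:R.
Proof.
case=> K uK; exists `|K| => //; near=> n.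
have -> : `|u n - l| <= `|K| / n%:R; last by [].
apply: (@le_trans _ _ (K / n%:R)); first by near: n.
by rewrite ler_wpM2r ?invr_ge0 // ler_norm.
Unshelve. all: by end_near. Qed.

Lemma rate_cvg u l : rate u l -> u n @[n --> \oo] --> l.
Proof.
case=> K uK; apply/cvgrPdist_le => e e0; near=> n.
rewrite distrC (@le_trans _ _ (K / n%:R)) //; first by near: n.
have [K0|K0] := ltP K 0.
  by rewrite (le_trans _ (ltW e0)) // mulr_le0_ge0 ?invr_ge0 // ltW.
rewrite ler_pdivrMr; last by rewrite ltr0n; near: n; exact: nbhs_infty_gt.
rewrite -ler_pdivrMl // mulrC; near: n; exact: nbhs_infty_ger.
Unshelve. all: by end_near. Qed.

Lemma rate_ext u v : (\forall n \near \oo, u n = v n) -> has_rate u -> has_rate v.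
Proof.
move=> uv [l [K uK]]; exists l, K; near=> n.
have <- : u n = v n by near: n.
by near: n.
Unshelve. all: by end_near. Qed.

Lemma rate_cst c : has_rate (fun=> c).
Proof. by exists c, 0; apply: nearW => n; rewrite subrr normr0 mul0r. Qed.

Lemma rateD u v : has_rate u -> has_rate v -> has_rate (fun n => u n + v n).
Proof.
move=> [l [K uK]] [k [L vL]]; exists (l + k), (K + L); near=> n.
have -> : u n + v n - (l + k) = (u n - l) + (v n - k) by ring.
rewrite (le_trans (ler_normD _ _)) // mulrDl lerD //; by near: n.
Unshelve. all: by end_near. Qed.

Lemma rateM u v : has_rate u -> has_rate v -> has_rate (fun n => u n * v n).
Proof.
move=> [l /rate_pos[K K0 uK]] [k /rate_pos[L L0 vL]].
(* The first summand controls [(u n - l) * v n], because [v n] is at most [|k| + L] in absolute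
   value once [n >= 1]. *)
exists (l * k), (K * (`|k| + L) + `|l| * L); near=> n.
have n0 : (0 < n)%N by near: n; exact: nbhs_infty_gt.
have un : `|u n - l| <= K / n%:R by near: n.
have vn : `|v n - k| <= L / n%:R by near: n.
have -> : u n * v n - l * k = (u n - l) * v n + l * (v n - k) by ring.
rewrite (le_trans (ler_normD _ _)) // !normrM mulrDl lerD //; last first.
  by rewrite -mulrA ler_wpM2l.
rewrite mulrAC ler_pM //.
rewrite -[v n](subrK k) addrC (le_trans (ler_normD _ _)) // lerD2l (le_trans vn) //.
by rewrite ler_piMr // invf_le1 ?ltr0n // ler1n.
Unshelve. all: by end_near. Qed.

Lemma rate_sum (I : Type) (s : seq I) (Q : pred I) (u : I -> nat -> R) :
  (forall i, Q i -> has_rate (u i)) ->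
  has_rate (fun n => \sum_(i <- s | Q i) u i n).
Proof.
move=> hu; elim: s => [|i s IH].
  apply: rate_ext (rate_cst 0); by apply: nearW => n; rewrite big_nil.
case Qi : (Q i).
  apply: rate_ext (rateD (hu i Qi) IH).
  by apply: nearW => n; rewrite big_cons Qi.
by apply: rate_ext IH; apply: nearW => n; rewrite big_cons Qi.
Qed.

Lemma rateX u k : has_rate u -> has_rate (fun n => u n ^+ k).
Proof.
move=> hu; elim: k => [|k IH].
  by apply: rate_ext (rate_cst 1); apply: nearW => n; rewrite expr0.
by apply: rate_ext (rateM hu IH); apply: nearW => n; rewrite exprS.
Qed.

Lemma rateN u : has_rate u -> has_rate (fun n => - u n).
Proof.
move=> hu; apply: rate_ext (rateM (rate_cst (-1)) hu).
by apply: nearW => n; rewrite mulN1r.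
Qed.

Lemma rateV u (c : R) : 0 < c -> (\forall n \near \oo, c <= u n) ->
  has_rate u -> has_rate (fun n => (u n)^-1).
Proof.
move=> c0 cu [l ul]; have ucl := rate_cvg ul.
have cl : c <= l.
  rewrite -(cvg_lim _ ucl) //; apply: limr_ge => //; exact: cvgP ucl.
have l0 : 0 < l by exact: lt_le_trans cl.
have [K K0 uK] := rate_pos ul.
(* The difference of inverses is [(l - u n) / (u n * l)], and [u n >= c]. *)
exists l^-1, (K / (c * l)); near=> n.
have un : `|u n - l| <= K / n%:R by near: n.
have cn : c <= u n by near: n.
have u0 : 0 < u n by exact: lt_le_trans cn.
have -> : (u n)^-1 - l^-1 = (l - u n) / (u n * l).
  by field; rewrite !gt_eqF.
rewrite normrM distrC normfV (gtr0_norm (mulr_gt0 u0 l0)) mulrAC.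
rewrite ler_pM ?invr_ge0 ?mulr_ge0 ?(ltW u0) ?(ltW l0) //.
by rewrite lef_pV2 ?posrE ?mulr_gt0 // ler_wpM2r // ltW.
Unshelve. all: by end_near. Qed.

Lemma rate_inv_pred : has_rate (fun n => n.-1%:R^-1).
Proof.
exists 0, 2; near=> n.
have n2 : (2 <= n)%N by near: n; exact: nbhs_infty_ge.
have p0 : (0 < n.-1)%N by lia.
rewrite subr0 normfV normr_nat -[X in _ <= X]invrK lef_pV2 ?posrE ?ltr0n //.
  by rewrite invfM invrK mulrC ler_pdivrMr // -natrM ler_nat; lia.
by rewrite invr_gt0 divr_gt0 // ltr0n; lia.
Unshelve. all: by end_near. Qed.

End rates.

(** * Asymptotics of the eigenvalues, the Green function and the coefficient *)

Section asymptotics.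
Variables (R : realType) (d : nat).

(** Division by [kappa] leaves a polynomial in [1 / (n - 1)] whose coefficients do not depend on
    [n]. *)
Lemma rate_krawtchouk j t : (j <= d)%N -> (t <= d)%N ->
  has_rate (fun n => krawtchouk R d n j t / kappa R d n j).
Proof.
move=> jd td.
pose u l n : R := (-1) ^+ l * 'C(t, l)%:R * 'C(d - t, j - l)%:R / 'C(d, j)%:R
  * n.-1%:R^-1 ^+ l.
apply: (@rate_ext _ (fun n => \sum_(l <- index_iota 0 j.+1) u l n)); last first.
  apply: rate_sum => l _; apply: rateM; first exact: rate_cst.
  exact/rateX/rate_inv_pred.
near=> n; rewrite krawtchouk_full // mulr_suml; apply: eq_big_nat => l.
rewrite ltnS => /= lj.
have n2 : (2 <= n)%N by near: n; exact: nbhs_infty_ge.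
have p0 : n.-1%:R != 0 :> R by rewrite pnatr_eq0; lia.
have b0 : 'C(d, j)%:R != 0 :> R by rewrite pnatr_eq0 -lt0n bin_gt0.
have pE : n.-1%:R ^+ j = n.-1%:R ^+ (j - l) * n.-1%:R ^+ l :> R.
  by rewrite -exprD subnK.
rewrite /u /kappa natrM natrX pE exprVn.
by field; rewrite b0 !expf_neq0.
Unshelve. all: by end_near. Qed.

Lemma rate_eigenvalue (J : nat -> nat -> R) t : (t <= d)%N ->
  (forall i, (1 <= i <= d)%N -> has_rate (fun n => shell_weight d n (J n) i)) ->
  has_rate (fun n => hamming_eigenvalue d n (J n) t).
Proof.
move=> td hw.
have hw' i : (i <= d)%N -> has_rate (fun n => shell_weight d n (J n) i).
  case: i => [_|i id]; last exact: hw.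
  (* The index range is repeated as a predicate because [rate_sum] hands only the predicate to its
     premise. *)
  apply: (@rate_ext _ (fun n => 1 + - \sum_(1 <= j < d.+1 | (1 <= j <= d)%N)
      shell_weight d n (J n) j)).
    apply: nearW => n; rewrite /shell_weight /=; congr (1 - _).
    rewrite [RHS]big_nat_cond [LHS]big_nat_cond.
    rewrite (eq_bigl (fun j => (1 <= j < d.+1)%N && true)) => [|j]; last first.
      by rewrite ltnS andbT andbb.
    by apply: eq_bigr => j /andP[/andP[j1 _] _]; rewrite gtn_eqF.
  by apply: rateD; [exact: rate_cst | apply/rateN/rate_sum].
apply: (@rate_ext _ (fun n => \sum_(0 <= j < d.+1 | (j <= d)%N)
   shell_weight d n (J n) j * (krawtchouk R d n j t / kappa R d n j))).
  apply: nearW => n; rewrite /hamming_eigenvalue.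
  rewrite [RHS]big_nat_cond [LHS]big_nat_cond.
  rewrite (eq_bigl (fun j => (0 <= j < d.+1)%N && true)) => [|j]; last first.
    by rewrite ltnS andbT andbb.
  by apply: eq_bigr => j _; ring.
by apply: rate_sum => j jd; apply: rateM; [exact: hw' | exact: rate_krawtchouk].
Qed.

(** A convex combination, with weights [shell_weight], of ratios of [krawtchouk] to [kappa], each at
    most 1. *)
Lemma eigenvalue_le1 n (J : nat -> R) t : (2 <= n)%N -> (t <= d)%N ->
  (forall i, (1 <= i <= d)%N -> 0 <= J i) ->
  \sum_(1 <= i < d.+1) kappa R d n i * J i <= 1 ->
  hamming_eigenvalue d n J t <= 1.
Proof.
move=> n2 td J0 J1.
have w0 j : (j <= d)%N -> 0 <= shell_weight d n J j.
  case: j => [_|j jd]; rewrite /shell_weight /=; first by rewrite subr_ge0.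
  by rewrite mulr_ge0 ?ler0n // J0.
have <- : \sum_(0 <= j < d.+1) shell_weight d n J j = 1.
  rewrite big_ltn // {1}/shell_weight eqxx.
  rewrite [X in _ + X](eq_big_nat _ _ (F2 := fun j => kappa R d n j * J j)).
    by rewrite subrK.
  by move=> j /andP[j1 _]; rewrite /shell_weight gtn_eqF.
rewrite ler_sum_nat // => j; rewrite ltnS => /= jd.
have k0 := kappa_gt0 R n2 jd.
rewrite -mulrA ler_piMr ?w0 // ler_pdivrMl // mulr1.
exact: le_trans (ler_norm _) (krawtchouk_le _ n2 jd td).
Qed.

(** Bernoulli's inequality. *)
Lemma sub1_expr_le (h : R) k : 0 <= h <= 1 -> 1 - (1 - h) ^+ k <= k%:R * h.
Proof.
move=> h01; elim: k => [|k IH]; first by rewrite expr0 subrr mul0r.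
have p1 : (1 - h) ^+ k <= 1 by apply: exprn_ile1; lra.
rewrite exprS mulrS; nra.
Qed.

(** * Estimates at fixed [n] *)

Section one_graph.
Variable n : nat.
Hypothesis n2 : (2 <= n)%N.
Local Notation h := (n%:R^-1 : R).

Let h01 : 0 < h <= 1.
Proof. by rewrite invr_gt0 ltr0n ltnW //= invf_le1 ?ler1n ?ltr0n ltnW. Qed.

Lemma prod_unit_interval (Q : pred 'I_d) (T : {set 'I_d}) :
  0 <= \prod_(i | Q i) (if i \in T then 1 - h else h) <= 1.
Proof.
apply: (big_ind (fun z => 0 <= z <= 1)) => [|a b /andP[a0 a1] /andP[b0 b1]|i _].
- by rewrite ler01 lexx.
- by rewrite mulr_ge0 //= mulr_ile1.
- by case: ifP => _; have := h01; lra.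
Qed.

(* On the set [D] of coordinates where [x] and [y] differ the projection kernel
   is exactly [h] up to sign; on the complement its factors are [1 - h] or [h]. *)
Lemma eigenproj_leading T (x y : config d n) (D := [set i | x i != y i]%SET) :
  (0 < d)%N ->
  `|eigenproj R T x y - h ^+ #|D| *
     (if ~: D \subset T then (-1) ^+ #|T :&: D| else 0)| <= d%:R * h ^+ #|D|.+1.
Proof.
move=> d0; have /andP[h0 h1] := h01.
have projE : eigenproj R T x y = h ^+ #|D| * ((-1) ^+ #|T :&: D| *
    \prod_(i | i \notin D) (if i \in T then 1 - h else h)).
  rewrite /eigenproj (bigID (mem D)) /= [RHS]mulrA; congr (_ * _).
    rewrite (eq_bigr (fun i => h * (if i \in T then -1 else 1))) => [|i]; last first.
      rewrite inE => /negbTE ->.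
      by case: ifP; rewrite ?mulr1 // mulrN1 sub0r.
    rewrite big_split prodr_const /=; congr (_ * _).
    rewrite -big_mkcondr prodr_const; congr (_ ^+ _).
    apply: eq_card => i. by rewrite [LHS]unfold_in /= !inE andbC.
  by apply: eq_bigr => i; rewrite inE negbK => ->.
have := prod_unit_interval [pred i | i \notin D] T.
rewrite projE -mulrBr normrM ger0_norm ?exprn_ge0 ?(ltW h0) //=.
rewrite exprSr mulrCA => p01; rewrite ler_wpM2l ?exprn_ge0 ?(ltW h0) //.
(* If [T] misses a coordinate outside [D], one factor of the remaining product is [h]; otherwise the
   product is a power of [1 - h], within [d * h] of 1. *)
case: ifP => DT; last first.
  have /fintype.subsetPn[i iD iT] := negbT DT.
  rewrite subr0 normrM normrX normrN1 expr1n mul1r ger0_norm; last first.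
    by case/andP: p01.
  have iD' : i \notin D by move: iD; rewrite finset.in_setC.
  rewrite (bigD1 i iD') /= (negbTE iT).
  have /andP[_ q1] := prod_unit_interval [pred j | (j \notin D) && (j != i)] T.
  rewrite (@le_trans _ _ h) //; first by rewrite ler_piMr ?(ltW h0).
  by rewrite ler_peMl ?(ltW h0) // ler1n.
rewrite -[X in _ - X]mulr1 -mulrBr normrM normrX normrN1 expr1n mul1r.
rewrite distrC ger0_norm; last by rewrite subr_ge0; case/andP: p01.
rewrite (eq_bigr (fun=> 1 - h)) => [|i iD]; last first.
  by rewrite (fintype.subsetP DT) // finset.in_setC.
rewrite prodr_const (le_trans (sub1_expr_le _ _)) ?(ltW h0) //.
rewrite ler_wpM2r ?(ltW h0) // ler_nat.
by rewrite -[X in (_ <= X)%N](card_ord d) max_card.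
Qed.

(** Such a [T] is determined by [T :&: D], an arbitrary subset of [D], and has [d - #|D|] further
    elements; the subsets are grouped by cardinality. *)
Lemma sum_superset (D : {set 'I_d}) (F : nat -> nat -> R) :
  \sum_(T : {set 'I_d} | ~: D \subset T) F #|T :&: D| #|T| =
  \sum_(0 <= i < #|D|.+1) 'C(#|D|, i)%:R * F i (i + d - #|D|)%N.
Proof.
have cardU (S : {set 'I_d}) : S \subset D -> #|S :|: ~: D| = (#|S| + d - #|D|)%N.
  move=> SD; rewrite cardsU.
  have -> : S :&: ~: D = finset.set0.
    apply/setP => i; rewrite !inE.
    by case: (boolP (i \in S)) => //= /(fintype.subsetP SD) ->.
  rewrite cards0 subn0 (cardsCs (~: D)) finset.setCK card_ord addnBA //.
  by rewrite -[X in (_ <= X)%N](card_ord d) max_card.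
rewrite (reindex_onto (fun S => S :|: ~: D) (fun T => T :&: D)) /=; last first.
  move=> T DT; apply/setP => i; rewrite !inE.
  have := fintype.subsetP DT i; rewrite !inE.
  by case: (i \in D); case: (i \in T) => //= ->.
rewrite (eq_bigl (fun S : {set 'I_d} => S \subset D)) => [|S]; last first.
  rewrite finset.subsetUr /=; apply/eqP/idP => [<-|SD]; first exact: finset.subsetIr.
  apply/setP => i; rewrite !inE; have := fintype.subsetP SD i.
  by case: (i \in S); case: (i \in D) => //= ->.
rewrite big_mkord.
pose p (S : {set 'I_d}) : 'I_#|D|.+1 := inord #|S|.
rewrite (partition_big p predT) //=; apply: eq_bigr => k _.
have pE (S : {set 'I_d}) : S \subset D -> (p S == k) = (#|S| == k).
  by move=> SD; rewrite -val_eqE /= inordK // ltnS subset_leq_card.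
rewrite (eq_bigr (fun=> F k (k + d - #|D|)%N)) => [|S /andP[SD]]; last first.
  rewrite pE // => /eqP Sk; rewrite cardU // Sk.
  suff -> : (S :|: ~: D) :&: D = S by rewrite Sk.
  apply/setP => i; rewrite !inE; have := fintype.subsetP SD i.
  by case: (i \in S); case: (i \in D) => //= ->.
rewrite sumr_const -[LHS]mulr_natl -cards_draws; congr (_%:R * _).
apply: eq_card => S; rewrite [LHS]unfold_in /= !inE.
by case SD: (S \subset D) => //=; rewrite pE.
Qed.

(** [eigenproj_leading] is summed over the [2 ^ d] sets, with coefficients at most [1 / m ^+ 2];
    [sum_superset] turns the leading terms into [cov_coef]. *)
Lemma green_leading (J : nat -> R) (m : R) (x y : config d n) :
  (0 < d)%N -> m != 0 ->
  (forall t, (t <= d)%N -> hamming_eigenvalue d n J t <= 1) ->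
  `|green J m x y - h ^+ hdist x y * cov_coef d n J m (hdist x y)|
  <= 2 ^+ d * (m ^+ 2)^-1 * d%:R * h ^+ (hdist x y).+1.
Proof.
move=> d0 m0 lam1; have m2 : 0 < m ^+ 2 by rewrite exprn_even_gt0.
pose r t := (1 + m ^+ 2 - hamming_eigenvalue d n J t)^-1.
have r0 t : (t <= d)%N -> `|r t| <= (m ^+ 2)^-1.
  move=> td; have := lam1 t td => l1.
  have D0 : 0 < 1 + m ^+ 2 - hamming_eigenvalue d n J t by lra.
  rewrite ger0_norm ?invr_ge0 ?(ltW D0) // lef_pV2 ?posrE //; lra.
pose D := [set i | x i != y i]%SET.
have hD : hdist x y = #|D| by apply: eq_card => i; rewrite !inE.
have -> : cov_coef d n J m (hdist x y) = \sum_(T : {set 'I_d})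
    r #|T| * (if ~: D \subset T then (-1) ^+ #|T :&: D| else 0).
  rewrite hD /cov_coef -(sum_superset D (fun i t => (-1) ^+ i * r t)).
  rewrite big_mkcond /=; apply: eq_bigr => T _.
  by case: ifP; rewrite ?mulr0 // mulrC.
rewrite /green mulr_sumr -sumrB (le_trans (ler_norm_sum _ _ _)) //.
have -> : 2 ^+ d * (m ^+ 2)^-1 * d%:R * h ^+ (hdist x y).+1 =
    \sum_(T : {set 'I_d}) (m ^+ 2)^-1 * (d%:R * h ^+ (hdist x y).+1).
  rewrite sumr_const (_ : #|_| = (2 ^ d)%N); last first.
    have := card_powerset [set: 'I_d]%SET; rewrite cardsT card_ord => <-.
    by apply: eq_card => T; rewrite !inE finset.subsetT.
  by rewrite -[RHS]mulr_natl natrX; ring.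
apply: ler_sum => T _.
rewrite (mulrCA (h ^+ _)) -mulrBr normrM ler_pM //.
  by rewrite r0 // card_set_ord_le.
by rewrite hD; exact: eigenproj_leading.
Qed.

End one_graph.

Lemma rate_cov_coef (J : nat -> nat -> R) (m : R) rho : m != 0 -> (rho <= d)%N ->
  (forall i, (1 <= i <= d)%N -> has_rate (fun n => shell_weight d n (J n) i)) ->
  (\forall n \near \oo, forall t, (t <= d)%N ->
     hamming_eigenvalue d n (J n) t <= 1) ->
  has_rate (fun n => cov_coef d n (J n) m rho).
Proof.
move=> m0 rd hw lam1; have m2 : 0 < m ^+ 2 by rewrite exprn_even_gt0.
apply: (@rate_ext _ (fun n => \sum_(0 <= i < rho.+1 | (i <= rho)%N)
  'C(rho, i)%:R * ((-1) ^+ i /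
      (1 + m ^+ 2 - hamming_eigenvalue d n (J n) (i + d - rho))))).
  apply: nearW => n; rewrite /cov_coef [RHS]big_nat_cond [LHS]big_nat_cond.
  by apply: eq_bigl => i; rewrite ltnS andbT andbb.
apply: rate_sum => i ir; have td : (i + d - rho <= d)%N by lia.
apply: rateM; first exact: rate_cst.
apply: rateM; first exact: rate_cst.
(* Eigenvalues at most 1 keep the denominators at or above [m ^+ 2]. *)
apply: (rateV m2).
  by apply: filterS lam1 => n /(_ _ td); lra.
by apply: rateD; [exact: rate_cst | apply/rateN/rate_eigenvalue].
Qed.

End asymptotics.

(* hJn fixes how the weights depend on n: w_i = kappa_i J_i is constant in n up
   to O(1/n). Without it the limit C may exist while being approached more
   slowly than 1/n, and the error term O(n^(-rho-1)) is then wrong. *)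
Theorem proposition3p9 (R : realType) (d : nat) (hd : (2 <= d)%N)
  (J : nat -> nat -> R)
  (hJ0 : forall n i, (2 <= n)%N -> (1 <= i <= d)%N -> 0 <= J n i)
  (hJ1 : forall n, (2 <= n)%N ->
     \sum_(1 <= i < d.+1) kappa R d n i * J n i <= 1)
  (hJn : forall i, (1 <= i <= d)%N -> exists w K : R,
     \forall n \near \oo, `|shell_weight d n (J n) i - w| <= K / n%:R)
  (m beta : R) (hm : 0 < m) (hbeta : 0 < beta)
  (disp : nat -> measure_display)
  (T : forall n, measurableType (disp n))
  (P : forall n, probability (T n) R)
  (g : forall n, config d n -> {RV (P n) >-> R})
  (hg : forall n, (2 <= n)%N -> is_gff (J n) m beta (g n))
  (rho : nat) (hrho : (rho <= d)%N)
  (C : R) (hC : cov_coef d n (J n) m rho @[n --> \oo] --> C) :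
  exists K : R, \forall n \near \oo,
    forall x x' : config d n, hdist x x' = rho ->
    (`|covariance (P n) (g n x) (g n x')
       - (C / beta * expR (- (rho%:R * ln n%:R)))%:E|
     <= (K / n%:R ^+ rho.+1)%:E)%E.
Proof.
have d0 : (0 < d)%N by exact: ltnW.
have m0 : m != 0 by rewrite gt_eqF.
have lam1 n t : (2 <= n)%N -> (t <= d)%N ->
    hamming_eigenvalue d n (J n) t <= 1.
  move=> n2 td; apply: eigenvalue_le1 => //; last exact: hJ1.
  by move=> i id; exact: hJ0.
have [l [K hK]] : has_rate (fun n => cov_coef d n (J n) m rho).
  apply: rate_cov_coef => //; near=> n; move=> t td; apply: lam1 => //.
  by near: n; exact: nbhs_infty_ge.
(* The limit supplied by the rate calculus is the assumed one, so [C] is approached with error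
   O(1/n). *)
have lC : l = C.
  by apply: (cvg_unique _ _ hC) => //; apply: rate_cvg; exists K.
rewrite {}lC in hK.
pose A : R := 2 ^+ d * (m ^+ 2)^-1 * d%:R.
(* [A] bounds the error of [green_leading] and [K] that of replacing [cov_coef] by [C]. Neither
   depends on the pair [x], [x'], so the bound is uniform. *)
exists ((A + K) / beta); near=> n; move=> x x' xx'.
have n2 : (2 <= n)%N by near: n; exact: nbhs_infty_ge.
have n0 : 0 < n%:R :> R by rewrite ltr0n ltnW.
have gap t : (t <= d)%N -> 1 + m ^+ 2 - hamming_eigenvalue d n (J n) t != 0.
  move=> td; have := lam1 n t n2 td; have : 0 < m ^+ 2 by rewrite exprn_gt0.
  by move=> ? ?; rewrite gt_eqF //; lra.
rewrite (gff_covariance n2 hbeta gap (hg n n2)) -EFinB abse_EFin lee_fin.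
have -> : expR (- (rho%:R * ln n%:R)) = n%:R^-1 ^+ rho :> R.
  by rewrite expRN expRM_natl lnK ?posrE // exprVn.
have main := @green_leading R d n n2 (J n) m x x' d0 m0 (fun t => @lam1 n t n2).
rewrite xx' -/A in main.
have coef : `|cov_coef d n (J n) m rho - C| <= K / n%:R by near: n.
set h := n%:R^-1 in main coef *.
have h0 : 0 <= h by rewrite invr_ge0 ltW.
have -> : green (J n) m x x' / beta - C / beta * h ^+ rho =
    ((green (J n) m x x' - h ^+ rho * cov_coef d n (J n) m rho)
     + h ^+ rho * (cov_coef d n (J n) m rho - C)) / beta by ring.
have -> : (A + K) / beta / n%:R ^+ rho.+1 =
    (A * h ^+ rho.+1 + h ^+ rho * (K * h)) / beta.
  by rewrite -exprVn -/h exprSr; ring.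
rewrite normrM normfV (gtr0_norm hbeta) ler_wpM2r ?invr_ge0 ?(ltW hbeta) //.
rewrite (le_trans (ler_normD _ _)) // lerD // normrM ger0_norm ?exprn_ge0 //.
by rewrite ler_wpM2l ?exprn_ge0.
Unshelve. all: by end_near. Qed.
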